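(* Fix partitions $\mu,\nu$. For each integer $k\ge0$ let $\Phi(\mu,\nu,k)$ be the partition with 2-quotient $(\mu,\nu)$ and 2-core $(k,k-1,\dots,1)$. Then for every $0\le j\le|\mu|+|\nu|$ there is a polynomial $P_j$ of degree at most $j$ such that the coefficient $r_{\Phi(\mu,\nu,k),j}$ equals $P_j(k)$ for all integers $k\ge0$.
   Context: Partitions $\lambda=(\lambda_1\ge\dots\ge\lambda_{\ell(\lambda)}>0)$, degree vector $n_i=\lambda_i+\ell(\lambda)-i$, $\Delta(n_\lambda)=\prod_{i<j}(n_j-n_i)$. Hermite: $\mathrm{He}_0=1,\mathrm{He}_1=x,\mathrm{He}_n=x\mathrm{He}_{n-1}-(n-1)\mathrm{He}_{n-2}$; $\mathrm{He}_\lambda=\mathrm{Wr}[\mathrm{He}_{n_1},\dots,\mathrm{He}_{n_{\ell(\lambda)}}]/\Delta(n_\lambda)$. Maya diagram: a set $M\subset\mathbb{Z}$ containing all sufficiently negative integers and finitely many non-negative ones; $\lambda(M)$ has parts the positive values of $\#\{n\notin M:n<m\}$, $m\in M$. $M_\lambda=\{n<0\}\cup\{n_i\}$, $M_\lambda+t=\{m+t:m\in M_\lambda\}$. For partitions $\mu,\nu$ and $k\in\mathbb{Z}$ choose $s,s'\ge0$ with $\ell(\nu)+s'-\ell(\mu)-s=k$ and set $\Phi(\mu,\nu,k)=\lambda(\{2m:m\in M_\mu+s\}\cup\{2m+1:m\in M_\nu+s'\})$. For $k\ge0$, $(\mu,\nu)$ is the 2-quotient and $(k,\dots,1)$ the 2-core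 of $\Phi(\mu,\nu,k)$. For $\lambda$ with 2-core $\bar\lambda$ and 2-quotient $(\mu,\nu)$ there is a monic polynomial $R_\lambda$ of degree $|\mu|+|\nu|$ with $\mathrm{He}_\lambda(x)=x^{|\bar\lambda|}R_\lambda(x^2)$, and $R_\lambda(x)=\sum_{j=0}^{|\mu|+|\nu|}r_{\lambda,j}x^{|\mu|+|\nu|-j}$. *)

(* Defs.v *)
From HB Require Import structures.
From mathcomp Require Import all_boot all_order all_algebra.
Set Implicit Arguments. Unset Strict Implicit. Unset Printing Implicit Defensive.
Import Order.TTheory GRing.Theory Num.Theory.
Local Open Scope ring_scope.

Definition is_partition (l : seq nat) : bool :=
  sorted (fun x y => (y <= x)%N) l && all (fun x => (0 < x)%N) l.

Definition psize (l : seq nat) : nat := sumn l.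

Definition degvec (l : seq nat) : seq nat :=
  [seq (nth 0%N l i + (size l - i.+1))%N | i <- iota 0 (size l)].

Fixpoint He_pair (n : nat) : {poly rat} * {poly rat} :=
  match n with
  | 0%N => (1, 'X)
  | m.+1 => let (a, b) := He_pair m in (b, 'X * b - (m.+1)%:R *: a)
  end.
Definition He (n : nat) : {poly rat} := (He_pair n).1.

Definition Wronskian (fs : seq {poly rat}) : {poly rat} :=
  \det (\matrix_(i < size fs, j < size fs) (fs`_j)^`(i)).

Definition Vdelta (ns : seq nat) : rat :=
  \prod_(i < size ns) \prod_(j < size ns | (i < j)%N)
     ((nth 0%N ns j)%:R - (nth 0%N ns i)%:R).

Definition HeP (l : seq nat) : {poly rat} :=
  (Vdelta (degvec l))^-1 *: Wronskian [seq He n | n <- degvec l].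

(* A Maya diagram containing every negative integer is encoded by the
   finite list S of its non-negative elements: M = {n < 0} u S.
   lambda(M) has as parts the positive values of #{n notin M : n < m},
   m in M (for such M only non-negative n can be missing). *)
Definition maya_count (S : seq nat) (m : nat) : nat :=
  count (fun n => n \notin S) (iota 0 m).
Definition maya_partition (S : seq nat) : seq nat :=
  sort (fun x y => (y <= x)%N)
    [seq maya_count S m | m <- undup S & (0 < maya_count S m)%N].

(* non-negative part of M_lambda + t, t >= 0:  {0..t-1} u {n_i + t} *)
Definition maya_shift (l : seq nat) (t : nat) : seq nat :=
  iota 0 t ++ [seq (n + t)%N | n <- degvec l].

(* Phi(mu,nu,k) for k >= 0, with the choice s = l(nu), s' = l(mu) + k,
   so that l(nu) + s' - l(mu) - s = k. *)
Definition Phi (mu nu : seq nat) (k : nat) : seq nat :=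
  let s := size nu in let s' := (size mu + k)%N in
  maya_partition
    ([seq (2 * m)%N | m <- maya_shift mu s]
       ++ [seq (2 * m).+1 | m <- maya_shift nu s']).

Definition staircase (k : nat) : seq nat := rev (iota 1 k).

(* Main.v *)
(* Write f_n(t) = sum_m n^_(2m) t^m / m!, so that He_n(x) = x^n f_n(-1/(2x^2)).
   If chi(n_1, ..., n_l) in Q[t] denotes the determinant of the
   f_(n_j)^(i) := sum_m n_j^_(i+2m) t^m / m! divided by the Vandermonde
   determinant, then He_lambda(x) = x^|lambda| chi(n_lambda)(-1/(2x^2)).  Moreover
   chi is symmetric and unchanged by translating the Maya diagram, so the j-th
   coefficient of R is, up to (-1/2)^j, the coefficient of t^j in
   chi(2A u {1, 3, ..., 2k-1} u (2(B+k)+1)), with A, B depending only on mu, nu.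

   Since f_n' = n(n-1) f_(n-2), differentiating the determinant expresses the
   coefficient of t^(j+1) by those of t^j after moving one bead down by 2.  The
   k beads at 1, 3, ..., 2k-1 cannot move, and their contribution to the weights
   of the other moves telescopes; hence the coefficient of t^j is a
   rational function of k of degree at most j without poles at naturals.

   On the other hand j! times this coefficient is an integer: it is a sum of
   determinants of values at the n_j of polynomials over Z, each divisible by the
   Vandermonde determinant.  A rational function taking values in (1/j!) Z on
   the naturals is a polynomial. *)
Require Import Defs.
From HB Require Import structures.
From mathcomp Require Import all_boot all_order all_algebra.
From mathcomp Require Import perm ring lra zify.
Import Order.TTheory GRing.Theory Num.Theory.
Local Open Scope ring_scope.
Set Implicit Arguments.
Unset Strict Implicit.
Unset Printing Implicit Defensive.

(** * Alternants *)

Lemma deriv_prod_seq (R : comNzRingType) (I : eqType) (r : seq I)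
    (F : I -> {poly R}) : uniq r ->
  (\prod_(i <- r) F i)^`() =
  \sum_(j <- r) \prod_(i <- r) (if i == j then (F i)^`() else F i).
Proof.
elim: r => [|a r IHr] /=; first by rewrite !big_nil derivC.
case/andP=> a_r r_uniq; rewrite !big_cons derivM IHr // eqxx; congr (_ * _ + _).
  by apply: eq_big_seq => i ir; case: eqP ir a_r => // -> ->.
rewrite mulr_sumr; apply: eq_big_seq => j jr.
by rewrite big_cons; case: eqP jr a_r => // -> ->.
Qed.

(** The product rule in the Leibniz expansion. The row form serves integrality; the column form
    below moves one bead at a time. *)
Lemma deriv_det (R : comNzRingType) n (M : 'M[{poly R}]_n) :
  (\det M)^`() =
  \sum_i \det (\matrix_(k, j) (if k == i then (M k j)^`() else M k j)).
Proof.
rewrite raddf_sum exchange_big /=; apply: eq_bigr => s _.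
have -> : (-1) ^+ s = ((-1) ^+ s)%:P :> {poly R} by rewrite rmorphXn rmorphN1.
rewrite mul_polyC derivZ deriv_prod_seq ?index_enum_uniq // -mul_polyC mulr_sumr.
apply: eq_bigr => i _; congr (_ * _).
by apply: eq_bigr => k _; rewrite mxE.
Qed.

Lemma deriv_det_col (R : comNzRingType) n (M : 'M[{poly R}]_n) :
  (\det M)^`() =
  \sum_j \det (\matrix_(i, k) (if k == j then (M i k)^`() else M i k)).
Proof.
rewrite -det_tr deriv_det; apply: eq_bigr => j _; rewrite -det_tr.
by congr (\det _); apply/matrixP => i k; rewrite !mxE.
Qed.

Definition alternant (A : comNzRingType) (F : nat -> nat -> A) (ns : seq nat) : A :=
  \det (\matrix_(i < size ns, j < size ns) F i (nth 0%N ns j)).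

(** A free dimension [n] lets size equations be used without casts between matrix types. *)
Lemma alternantE (A : comNzRingType) (F : nat -> nat -> A) n ns : size ns = n ->
  alternant F ns = \det (\matrix_(i < n, j < n) F i (nth 0%N ns j)).
Proof. by move=> <-. Qed.

Lemma eq_alternant (A : comNzRingType) (F G : nat -> nat -> A) ns :
  (forall i n, n \in ns -> F i n = G i n) -> alternant F ns = alternant G ns.
Proof.
move=> eqFG; congr (\det _); apply/matrixP => i j; rewrite !mxE eqFG //.
exact: mem_nth.
Qed.

(* The sign depends on the permutation alone, so that ratios of alternants do
   not depend on the order of their arguments, even after the substitution [h]. *)
Lemma perm_alternant (s t : seq nat) : perm_eq s t ->
  exists b : bool, forall (A : comNzRingType) (F : nat -> nat -> A) (h : nat -> nat),
    alternant F (map h s) = (-1) ^+ b * alternant F (map h t).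
Proof.
move=> st; have sz_st := perm_size st.
have /tuple_permP[p ps] : perm_eq s (in_tuple t) by [].
exists (odd_perm p) => A F h.
rewrite !(@alternantE _ _ (size t)) ?size_map //.
rewrite -[LHS]det_tr -[X in _ * X]det_tr -det_perm -det_mulmx -row_permE.
congr (\det _); apply/matrixP => i j; rewrite !mxE.
rewrite !(nth_map 0%N) ?sz_st // ps.
by rewrite -(tnth_nth 0%N) tnth_mktuple (tnth_nth 0%N).
Qed.

Lemma alternant_notuniq (A : comNzRingType) (F : nat -> nat -> A) ns :
  ~~ uniq ns -> alternant F ns = 0.
Proof.
move=> /(uniqPn 0%N)[i [j [ij jn eq_ij]]]; rewrite /alternant -det_tr.
have i_n := ltn_trans ij jn.
rewrite (determinant_alternate (i1 := Ordinal i_n) (i2 := Ordinal jn)) //.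
  by rewrite -val_eqE /= ltn_eqF.
by move=> k; rewrite !mxE /= eq_ij.
Qed.

Lemma VdeltaE ns : Vdelta ns = alternant (fun i n => n%:R ^+ i) ns.
Proof.
have := det_Vandermonde (\row_(j < size ns) (nth 0%N ns j)%:R : 'rV[rat]_(size ns)).
rewrite /alternant => E.
transitivity (\det (Vandermonde (size ns)
    (\row_(j < size ns) (nth 0%N ns j)%:R : 'rV[rat]_(size ns)))).
  by rewrite E /Vdelta; apply: eq_bigr => i _; apply: eq_bigr => j _; rewrite !mxE.
by congr (\det _); apply/matrixP => i j; rewrite !mxE.
Qed.

Lemma Vdelta_cons n ns :
  Vdelta (n :: ns) = \prod_(m <- ns) (m%:R - n%:R) * Vdelta ns.
Proof.
rewrite /Vdelta /= big_ord_recl /=; congr (_ * _).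
  rewrite big_mkcond big_ord_recl /= mul1r (big_nth 0%N) big_mkord.
  by apply: eq_bigr.
by apply: eq_bigr => i _; rewrite big_mkcond big_ord_recl /= mul1r -big_mkcond.
Qed.

Lemma Vdelta_neq0 ns : uniq ns -> Vdelta ns != 0.
Proof.
elim: ns => [|n ns IHns]; first by rewrite /Vdelta big_ord0 oner_eq0.
case/andP=> n_ns ns_uniq; rewrite Vdelta_cons mulf_neq0 ?IHns //.
rewrite prodf_seq_neq0; apply/allP => m m_ns /=.
by rewrite subr_eq0 eqr_nat; apply: contraNneq n_ns => <-.
Qed.

Lemma Vdelta_map_succ ns : Vdelta (map succn ns) = Vdelta ns.
Proof.
elim: ns => [|n ns IHns] //=; rewrite !Vdelta_cons IHns big_map; congr (_ * _).
by apply: eq_bigr => m _; rewrite -!natr1 opprD addrACA subrr addr0.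
Qed.

(** * Normalised Hermite alternants *)

(* [hgen i n] evaluated at [- (2 * x ^+ 2)^-1] is [x ^ (i - n)] times the [i]-th
   derivative of [He n] at [x]. *)
Definition hgen (i n : nat) : {poly rat} :=
  \poly_(m < n.+1) ((n ^_ (i + 2 * m))%:R / m`!%:R).

Lemma coef_hgen i n m : (hgen i n)`_m = (n ^_ (i + 2 * m))%:R / m`!%:R.
Proof.
rewrite coef_poly ltnS; case: leqP => // nm.
by rewrite ffact_small ?mul0r //; lia.
Qed.

Lemma deriv_hgen i n : (hgen i n)^`() = hgen i.+2 n.
Proof.
apply/polyP => m; rewrite coef_deriv !coef_hgen factS natrM.
have -> : (i.+2 + 2 * m = i + 2 * m.+1)%N by lia.
by rewrite -[LHS]mulr_natr invfM [_^-1 / _]mulrC mulrA mulfVK ?pnatr_eq0.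
Qed.

Lemma hgenSS i n : hgen i.+1 n.+1 = n.+1%:R *: hgen i n.
Proof. by apply/polyP => m; rewrite coefZ !coef_hgen addSn ffactSS natrM mulrA. Qed.

(** The truncated predecessors are harmless: for [n <= 1] both sides vanish. *)
Lemma hgen_pred2 i n : hgen i.+2 n = (n * n.-1)%:R *: hgen i n.-2.
Proof.
by apply/polyP => m; rewrite coefZ !coef_hgen !addSn !ffactnS mulnA natrM mulrA.
Qed.

Definition chi (ns : seq nat) : {poly rat} := (Vdelta ns)^-1 *: alternant hgen ns.

(** For repeated beads both determinants vanish, so the identity survives the division by zero
    inside [chi]. *)
Lemma alternant_hgenE ns : alternant hgen ns = Vdelta ns *: chi ns.
Proof.
have [ns_uniq|ns_nuniq] := boolP (uniq ns).
  by rewrite scalerA divff ?scale1r // Vdelta_neq0.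
by rewrite VdeltaE !alternant_notuniq // scale0r.
Qed.

Lemma perm_chi s t : perm_eq s t -> chi s = chi t.
Proof.
move=> /perm_alternant[b altE]; rewrite /chi !VdeltaE.
have := altE _ (fun i n => n%:R ^+ i : rat) id; rewrite !map_id => ->.
have := altE _ hgen id; rewrite !map_id => ->.
by case: b {altE}; rewrite ?expr1 ?expr0 ?mul1r // !mulN1r invrN scaleNr scalerN opprK.
Qed.

(** The column of bead 0 is the first unit vector. After expansion along it, [hgenSS] extracts
    [m.+1] from each other column, which gives exactly the new Vandermonde factors. *)
Lemma chi_cons0 ns : chi (0%N :: map succn ns) = chi ns.
Proof.
rewrite /chi Vdelta_cons Vdelta_map_succ big_map.
have -> : alternant hgen (0%N :: map succn ns) =
    (\prod_(m <- ns) (m.+1%:R - 0%:R)) *: alternant hgen ns.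
  rewrite (@alternantE _ _ (size ns).+1) /= ?size_map // (expand_det_col _ ord0).
  rewrite big_ord_recl big1 => [|i _]; last first.
    rewrite mxE (_ : hgen _ _ = 0) ?mul0r //.
    by apply/polyP => m; rewrite coef_hgen ffact0n coef0 mul0r.
  rewrite mxE addr0 /= (_ : hgen 0 0 = 1); last first.
    apply/polyP => m; rewrite coef_hgen ffact0n coef1.
    by case: m => [|m] /=; rewrite ?divr1 ?mul0r.
  rewrite mul1r /cofactor expr0 mul1r.
  transitivity (\det (\matrix_(i < size ns, j < size ns) hgen i (nth 0%N ns j)
      *m diag_mx (\row_j (nth 0%N ns j).+1%:R%:P))).
    congr (\det _); apply/matrixP => i j; rewrite mul_mx_diag !mxE !lift0.
    by rewrite /= (nth_map 0%N) // hgenSS mulrC mul_polyC.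
  rewrite det_mulmx det_diag mulrC -mul_polyC rmorph_prod; congr (_ * _).
  rewrite (big_nth 0%N) big_mkord; apply: eq_bigr => j _.
  by rewrite mxE subr0.
rewrite scalerA; congr (_ *: _); rewrite invfM mulrAC mulVf ?mul1r //.
by rewrite prodf_seq_neq0; apply/allP => m _ /=; rewrite subr0 pnatr_eq0.
Qed.

Lemma deriv_alternant_hgen ns :
  (alternant hgen ns)^`() = \sum_(j < size ns)
    (nth 0%N ns j * (nth 0%N ns j).-1)%:R *:
    alternant hgen [seq (if i == j :> nat then (nth 0%N ns j).-2 else nth 0%N ns i)
                   | i <- iota 0 (size ns)].
Proof.
rewrite deriv_det_col; apply: eq_bigr => j _; set c := (_ * _)%N.
rewrite (@alternantE _ _ (size ns)) ?size_map ?size_iota //.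
rewrite -mul_polyC.
have -> : (c%:R)%:P = \det (diag_mx (\row_(k < size ns) 
    if k == j then c%:R%:P else 1 : {poly rat})).
  rewrite det_diag (bigD1 j) //= mxE eqxx big1 ?mulr1 // => k kj.
  by rewrite mxE (negbTE kj).
rewrite mulrC -det_mulmx; congr (\det _); apply/matrixP => i k.
rewrite mul_mx_diag !mxE (nth_map 0%N) ?size_iota // nth_iota // add0n -val_eqE.
case: eqP => [->|_]; last by rewrite mulr1.
by rewrite deriv_hgen hgen_pred2 mulrC mul_polyC.
Qed.

(** Each column derivative lowers one bead by 2; the product is the ratio of the Vandermonde
    determinants after and before the move. *)
Lemma deriv_chi ns : uniq ns ->
  (chi ns)^`() = \sum_(n <- ns)
    ((n * n.-1)%:R * \prod_(m <- rem n ns) ((n.-2%:R - m%:R) / (n%:R - m%:R)))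
    *: chi (n.-2 :: rem n ns).
Proof.
move=> ns_uniq; rewrite derivZ deriv_alternant_hgen scaler_sumr.
rewrite [RHS](big_nth 0%N) big_mkord; apply: eq_bigr => j _.
set a := nth 0%N ns j; set c := (a * _)%N.
pose h i := if i == j :> nat then a.-2 else nth 0%N ns i; rewrite -/h.
have j_iota : val j \in iota 0 (size ns) by rewrite mem_iota add0n /=.
(* Permuting positions rather than beads gives one sign [b], valid both before and after the move,
   so that it cancels. *)
have [b altE] := perm_alternant (perm_to_rem j_iota).
set It := iota 0 (size ns) in j_iota altE *.
have nsE : map (nth 0%N ns) It = ns by exact: (mkseq_nth 0%N ns).
set rest := map (nth 0%N ns) (rem (val j) It).
have hrest : map h (rem (val j) It) = rest.
  apply/eq_in_map => i; rewrite mem_rem_uniq ?iota_uniq // inE => /andP[/negbTE ij _].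
  by rewrite /h ij.
have VE : Vdelta ns = (-1) ^+ b * (\prod_(m <- rest) (m%:R - a%:R) * Vdelta rest).
  by rewrite -Vdelta_cons !VdeltaE -[in LHS]nsE altE.
have perm_rest : perm_eq rest (rem a ns).
  rewrite -(perm_cons a) -(permPr (perm_to_rem (mem_nth 0%N (ltn_ord j)))).
  by rewrite -[X in perm_eq _ X]nsE perm_sym (perm_map _ (perm_to_rem j_iota)).
have V0 : Vdelta ns != 0 by exact: Vdelta_neq0.
rewrite altE /= hrest {1}/h eqxx alternant_hgenE Vdelta_cons.
have -> : chi (a.-2 :: rest) = chi (a.-2 :: rem a ns).
  by apply: perm_chi; rewrite perm_cons.
have -> : (-1) ^+ b = ((-1) ^+ b)%:P :> {poly rat} by rewrite rmorphXn rmorphN1.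
rewrite mul_polyC; move: (chi _) => X; rewrite !scalerA; congr (_ *: _).
rewrite VE in V0 *; rewrite -(perm_big _ perm_rest) /=.
have -> : \prod_(m <- rest) ((a.-2%:R - m%:R) / (a%:R - m%:R)) =
   \prod_(m <- rest) (m%:R - a.-2%:R) / \prod_(m <- rest) (m%:R - a%:R) :> rat.
  rewrite -prodf_div; apply: eq_bigr => m _.
  by rewrite -opprB -[in X in _ / X]opprB invrN mulrNN.
move: V0; rewrite !mulf_eq0 !negb_or => /and3P[sb P0 W0].
by field; rewrite P0 W0 sb.
Qed.

(** * Integrality and constant term of [chi] *)

Lemma alternant_horner (A : comNzRingType) (f : nat -> {poly A}) ns :
  (forall i, (i < size ns)%N -> (size (f i) <= size ns)%N) ->
  alternant (fun i n => (f i).[n%:R]) ns =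
  \det (\matrix_(i < size ns, q < size ns) (f i)`_q) *
  alternant (fun i n => n%:R ^+ i) ns.
Proof.
move=> sz_f; rewrite -det_mulmx; congr (\det _); apply/matrixP => i j.
rewrite !mxE (horner_coef_wide _ (sz_f i _)) //.
by apply: eq_bigr => q _; rewrite !mxE.
Qed.

(* Reducing the polynomials modulo the monic polynomial with roots [ns] does
   not change their values on [ns] and keeps the coefficients in [A]. *)
Lemma dvd_alternant_horner (A : comNzRingType) (f : nat -> {poly A}) ns :
  exists z : A, alternant (fun i n => (f i).[n%:R]) ns =
                z * alternant (fun i n => n%:R ^+ i) ns.
Proof.
pose Q : {poly A} := \prod_(n <- ns) ('X - n%:R%:P).
have Q_monic : Q \is monic by exact: monic_prod_XsubC.
pose g i := Pdiv.CommonRing.rmodp (f i) Q.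
exists (\det (\matrix_(i < size ns, q < size ns) (g i)`_q)).
rewrite -alternant_horner; last first.
  move=> i _; rewrite -ltnS -(size_prod_XsubC ns (fun n => n%:R : A)).
  exact/Pdiv.CommonRing.ltn_rmodpN0/monic_neq0.
apply: eq_alternant => i n n_ns.
rewrite [in LHS](Pdiv.RingMonic.rdivp_eq Q_monic (f i)) hornerD hornerM.
suff /rootP -> : root Q n%:R by rewrite mulr0 add0r.
by rewrite /Q /root horner_prod (big_rem n) //= hornerXsubC subrr mul0r.
Qed.

Lemma natr_ffact (A : comNzRingType) n p :
  (n ^_ p)%:R = \prod_(0 <= m < p) (n%:R - m%:R) :> A.
Proof.
elim: p => [|p IHp]; first by rewrite big_nil.
rewrite big_nat_recr //= ffactnSr natrM -IHp /=; case: (leqP p n) => [pn|np].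
  by rewrite natrB.
by rewrite ffact_small // !mul0r.
Qed.

(** Divisibility by the Vandermonde determinant is obtained over [int], then transported to
    [rat]. *)
Lemma alternant_ffact_int (p : nat -> nat) ns : exists z : int,
  alternant (fun i n => (n ^_ (p i))%:R : rat) ns = z%:~R * Vdelta ns.
Proof.
have [z zE] := @dvd_alternant_horner int
  (fun i => \prod_(0 <= m < p i) ('X - m%:R%:P)) ns.
have intrE F : (alternant F ns)%:~R = alternant (fun i n => (F i n)%:~R : rat) ns.
  by rewrite -det_map_mx; congr (\det _); apply/matrixP => i j; rewrite !mxE.
exists z; rewrite VdeltaE; move/(congr1 (fun x : int => x%:~R : rat)): zE.
rewrite rmorphM /= !intrE => zE.
transitivity (z%:~R * alternant (fun i n => ((n%:R : int) ^+ i)%:~R : rat) ns); last first.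
  by congr (_ * _); apply: eq_alternant => i n _; rewrite rmorphXn /= rmorph_nat.
rewrite -zE; apply: eq_alternant => i n _.
rewrite horner_prod natr_ffact rmorph_prod; apply: eq_bigr => m _.
by rewrite hornerXsubC rmorphB /= !rmorph_nat.
Qed.

(** A derivative adds 2 to one row index, hence the general indices [p]; at 0 only falling
    factorials remain. *)
Lemma alternant_hgen_int J (p : nat -> nat) ns : exists z : int,
  ((alternant (fun i n => hgen (p i) n) ns)^`(J)).[0] = z%:~R * Vdelta ns.
Proof.
elim: J p => [|J IHJ] p.
  have [z zE] := alternant_ffact_int p ns; exists z; rewrite -zE.
  rewrite derivn0 -horner_evalE -det_map_mx; congr (\det _).
  apply/matrixP => i j; rewrite !mxE /= horner_evalE horner_coef0 coef_hgen.
  by rewrite addn0 divr1.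
rewrite derivSn deriv_det linear_sum horner_sum /=.
apply: (big_ind (fun x => exists z : int, x = z%:~R * Vdelta ns)).
- by exists 0; rewrite mul0r.
- by move=> _ _ [y ->] [z ->]; exists (y + z); rewrite rmorphD mulrDl.
move=> i _; have [z zE] := IHJ (fun k => if k == i :> nat then (p k).+2 else p k).
exists z; rewrite -zE; congr (_^`(_)).[_]; congr (\det _); apply/matrixP => k j; rewrite !mxE.
by rewrite -val_eqE; case: eqP => // _; rewrite deriv_hgen.
Qed.

Lemma chi_coef_int ns J : exists z : int, J`!%:R * (chi ns)`_J = z%:~R.
Proof.
have [ns_uniq|ns_nuniq] := boolP (uniq ns); last first.
  exists 0; rewrite coefZ VdeltaE [alternant _ ns]alternant_notuniq //.
  by rewrite invr0 mul0r mulr0.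
have [z] := alternant_hgen_int J id ns.
rewrite -[alternant _ _]/(alternant hgen ns) alternant_hgenE => zE; exists z.
apply: (mulIf (Vdelta_neq0 ns_uniq)); rewrite -zE horner_coef0 coef_derivn addn0.
by rewrite ffactnn -[LHS]mulrA mulr_natl [in RHS]coefZ mulrC.
Qed.

(** At 0, row [i] holds the values of a monic polynomial of degree [i]: the coefficient matrix is
    unitriangular and only the Vandermonde determinant is left. *)
Lemma chi_coef0 ns : uniq ns -> (chi ns)`_0 = 1.
Proof.
move=> ns_uniq; apply: (mulfI (Vdelta_neq0 ns_uniq)).
rewrite -coefZ -alternant_hgenE mulr1 -horner_coef0 -horner_evalE -det_map_mx.
pose f i : {poly rat} := \prod_(0 <= m < i) ('X - m%:R%:P).
have sz_f i : size (f i) = i.+1 by rewrite size_prod_XsubC size_iota subn0.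
transitivity (alternant (fun i n => (f i).[n%:R]) ns).
  congr (\det _); apply/matrixP => i j; rewrite !mxE /= horner_evalE horner_coef0 coef_hgen.
  rewrite addn0 divr1 natr_ffact horner_prod.
  by apply: eq_bigr => m _; rewrite hornerXsubC.
rewrite alternant_horner => [|i]; last by rewrite sz_f.
rewrite -VdeltaE det_trig; last first.
  by apply/is_trig_mxP => i j ij; rewrite !mxE nth_default // sz_f.
rewrite big1 ?mul1r // => i _; rewrite mxE.
have /monicP := monic_prod_XsubC (index_iota 0 i) xpredT (fun m => m%:R : rat).
by rewrite lead_coefE sz_f.
Qed.

(** * Rational functions on the natural numbers *)

(** Comparing sizes bounds the degree of the quotient by [d] and also admits [N = 0]. *)
Definition ratfun (d : nat) (f : nat -> rat) : Prop :=
  exists N D : {poly rat},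
    [/\ forall k : nat, D.[k%:R] != 0, (size N <= size D + d)%N
      & forall k : nat, f k = N.[k%:R] / D.[k%:R]].

Lemma eq_ratfun d f g : f =1 g -> ratfun d f -> ratfun d g.
Proof. by move=> fg [N [D [D0 sz ND]]]; exists N, D; split=> // k; rewrite -fg. Qed.

Lemma ratfun_frac d (N D : {poly rat}) : (forall k : nat, D.[k%:R] != 0) ->
  (size N <= size D + d)%N -> ratfun d (fun k => N.[k%:R] / D.[k%:R]).
Proof. by move=> D0 sz; exists N, D. Qed.

Lemma ratfun_horner d (P : {poly rat}) : (size P <= d.+1)%N ->
  ratfun d (fun k => P.[k%:R]).
Proof.
move=> sz; exists P, 1; split=> [k||k]; rewrite ?hornerC ?oner_eq0 ?divr1 //.
by rewrite size_poly1 add1n.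
Qed.

Lemma ratfun_const d c : ratfun d (fun=> c).
Proof.
apply: (@eq_ratfun _ (fun k : nat => c%:P.[k%:R])) => [k|]; first by rewrite hornerC.
by apply: ratfun_horner; rewrite (leq_trans (size_polyC_leq1 c)).
Qed.

Lemma horner_natr_neq0 (D : {poly rat}) : (forall k : nat, D.[k%:R] != 0) -> D != 0.
Proof. by move/(_ 0%N); apply: contraNneq => ->; rewrite horner0. Qed.

Lemma ratfunD d f g : ratfun d f -> ratfun d g -> ratfun d (fun k => f k + g k).
Proof.
move=> [N1 [D1 [D1k sz1 fE]]] [N2 [D2 [D2k sz2 gE]]].
exists (N1 * D2 + N2 * D1), (D1 * D2); split=> [k||k].
- by rewrite hornerM mulf_neq0.
- have D1n0 := horner_natr_neq0 D1k; have D2n0 := horner_natr_neq0 D2k.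
  apply: leq_trans (size_polyD _ _) _; rewrite geq_max [size (D1 * D2)]size_mul //.
  have := size_polyMleq N1 D2; have := size_polyMleq N2 D1.
  move: D1n0 D2n0 sz1 sz2; rewrite -!size_poly_gt0.
  move: (size (N1 * D2)) (size (N2 * D1)) (size N1) (size N2) (size D1) (size D2).
  lia.
by rewrite fE gE hornerD !hornerM; field; rewrite D1k D2k.
Qed.

Lemma ratfunM d e f g : ratfun d f -> ratfun e g -> ratfun (d + e) (fun k => f k * g k).
Proof.
move=> [N1 [D1 [D1k sz1 fE]]] [N2 [D2 [D2k sz2 gE]]].
exists (N1 * N2), (D1 * D2); split=> [k||k].
- by rewrite hornerM mulf_neq0.
- have D1n0 := horner_natr_neq0 D1k; have D2n0 := horner_natr_neq0 D2k.
  rewrite [size (D1 * D2)]size_mul //; have := size_polyMleq N1 N2.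
  move: D1n0 D2n0 sz1 sz2; rewrite -!size_poly_gt0.
  move: (size (N1 * N2)) (size N1) (size N2) (size D1) (size D2).
  lia.
by rewrite fE gE !hornerM; field; rewrite D1k D2k.
Qed.

Lemma ratfun_sum d (I : Type) (r : seq I) (F : I -> nat -> rat) :
  (forall i, ratfun d (F i)) -> ratfun d (fun k => \sum_(i <- r) F i k).
Proof.
move=> rF; elim: r => [|i r IHr].
  by apply: eq_ratfun (ratfun_const d 0) => k; rewrite big_nil.
by apply: eq_ratfun (ratfunD (rF i) IHr) => k; rewrite big_cons.
Qed.

Lemma ratfun_prod (I : Type) (r : seq I) (F : I -> nat -> rat) :
  (forall i, ratfun 0 (F i)) -> ratfun 0 (fun k => \prod_(i <- r) F i k).
Proof.
move=> rF; elim: r => [|i r IHr].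
  by apply: eq_ratfun (ratfun_const 0 1) => k; rewrite big_nil.
by apply: eq_ratfun (ratfunM (rF i) IHr) => k; rewrite big_cons.
Qed.

Lemma poly_eventually_pos (p : {poly rat}) : 0 < lead_coef p ->
  exists K d : rat, 0 < d /\ forall x, K <= x -> d <= p.[x].
Proof.
elim/poly_ind: p => [|p c IHp]; first by rewrite lead_coef0 ltxx.
have [->|p0] := eqVneq p 0.
  rewrite mul0r add0r lead_coefC => c0; exists 0, c; split=> // x _.
  by rewrite hornerC.
rewrite lead_coefDl; last first.
  by rewrite size_mulX // (leq_ltn_trans (size_polyC_leq1 c)) // ltnS size_poly_gt0.
rewrite lead_coefMX => /IHp[K [d [d0 dp]]].
(* Beyond this threshold [p.[x] * x + c >= d * x + c >= 1]. *)
exists (Num.max K (Num.max 1 ((1 - c) / d))), 1; split=> // x.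
rewrite !ge_max => /and3P[Kx x1 cx]; rewrite hornerD hornerMX hornerC.
have: d * x <= p.[x] * x by rewrite ler_wpM2r ?dp // (le_trans ler01).
by move: cx; rewrite ler_pdivrMr // mulrC; lra.
Qed.

Lemma natr_ubound (x : rat) : exists K : nat, x <= K%:R.
Proof.
exists (Num.bound `|x|); apply: ltW.
exact: le_lt_trans (ler_norm x) (archi_boundP (normr_ge0 x)).
Qed.

(* Writing [f = Q + S/D] with [Q] polynomial and [deg S < deg D], the
   remainder [S/D] takes values in [c^-1 Z] for some [c] and tends to [0]. *)
Lemma ratfun_int_poly d f (c : nat) : (0 < c)%N -> ratfun d f ->
  (forall k, exists z : int, c%:R * f k = z%:~R) ->
  exists P : {poly rat}, (size P <= d.+1)%N /\ forall k, f k = P.[k%:R].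
Proof.
move=> c0 [N [D [Dk szN fE]]] f_int; have D0 := horner_natr_neq0 Dk.
set Q := N %/ D; set S := N %% D.
have [Qz [a a0 QE]] := rat_poly_scale Q.
(* The factor [c] makes the values of [f] integral and [a] clears the denominators of [Q]. *)
have S_int k : exists z : int, ((c%:R * a%:~R) *: S).[k%:R] / D.[k%:R] = z%:~R.
  have [z zE] := f_int k; exists (a * z - c%:Z * Qz.[k%:R]).
  have -> : (a * z - c%:Z * Qz.[k%:R])%:~R =
      a%:~R * (c%:R * f k) - c%:R * (a%:~R * Q.[k%:R]) :> rat.
    rewrite rmorphB !rmorphM /= -zE QE hornerZ mulVKf ?intr_eq0 //.
    have -> : k%:R = (k%:R : int)%:~R :> rat by rewrite rmorph_nat.
    by rewrite -pmulrn horner_map.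
  rewrite fE [N in RHS](divp_eq N D) -/Q -/S hornerD hornerM hornerZ.
  by field; exact: Dk.
have S0 : S = 0.
  apply/eqP/negPn/negP => S0.
  set T := _ *: S in S_int.
  have T0 : T != 0.
    by rewrite scaler_eq0 mulf_eq0 intr_eq0 pnatr_eq0 eqn0Ngt c0 (negbTE a0) (negbTE S0).
  have szT : (size T < size D)%N by rewrite (leq_ltn_trans (size_scale_leq _ _)) // ltn_modp.
  (* As [T] has smaller degree than [D], eventually [T ^+ 2 < D ^+ 2]; squares avoid a discussion of
     signs. *)
  have lc : 0 < lead_coef (D ^+ 2 - T ^+ 2).
    rewrite lead_coefDl ?lead_coefN ?lead_coef_exp ?exprn_even_gt0 ?lead_coef_eq0 //.
    rewrite size_polyN !expr2 !size_mul //; move: szT T0; rewrite -size_poly_gt0.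
    by move: (size T) (size D); lia.
  have [K [e [e0 eP]]] := poly_eventually_pos lc.
  have [k0 Kk0] := natr_ubound K.
  (* From [k0] on, the integer [T / D] has square below 1, so it is 0. This gives [T] too many
     roots. *)
  have Troot k : (k0 <= k)%N -> T.[k%:R] = 0.
    move=> k0k; have := eP k%:R; rewrite (le_trans Kk0) ?ler_nat // => /(_ isT).
    rewrite hornerD hornerN !horner_exp.
    have [z /(canRL (divfK (Dk k))) ->] := S_int k.
    rewrite exprMn => ez.
    have : z%:~R ^+ 2 < 1 :> rat.
      have D2 : 0 < D.[k%:R] ^+ 2 by rewrite exprn_even_gt0 ?Dk.
      by rewrite -(ltr_pM2r D2) mul1r -subr_gt0 (lt_le_trans e0).
    rewrite -rmorphXn -[1]/(1%:~R) ltr_int => z1.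
    have -> : z = 0 by move: z1; rewrite expr2; nia.
    by rewrite mul0r.
  have : (size T <= size [seq k%:R : rat | k <- iota k0 (size T)])%N.
    by rewrite size_map size_iota.
  move: T0; apply/contraNnot => szle; rewrite (roots_geq_poly_eq0 _ _ szle) //.
    by apply/allP => _ /mapP[k + ->]; rewrite mem_iota => /andP[k0k _]; apply/rootP/Troot.
  by rewrite map_inj_uniq ?iota_uniq // => x y /eqP; rewrite eqr_nat => /eqP.
exists Q; split=> [|k].
  rewrite size_divp //; move: D0 szN; rewrite -size_poly_gt0.
  by move: (size N) (size D); lia.
by rewrite fE [N](divp_eq N D) -/Q -/S S0 addr0 hornerM mulfK.
Qed.

(** * Bead configurations with a given 2-quotient *)

(** Neither [A] nor [B] involves [k], and the moves that matter change only these lists, so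
    induction over moves is uniform in [k]. *)
Definition beads (A B : seq nat) (k : nat) : seq nat :=
  [seq (2 * a)%N | a <- A] ++ [seq (2 * m).+1 | m <- iota 0 k ++ [seq (b + k)%N | b <- B]].

Lemma perm_beads A A' B B' k :
  perm_eq A A' -> perm_eq B B' -> perm_eq (beads A B k) (beads A' B' k).
Proof. by move=> AA' BB'; rewrite perm_cat ?perm_map // perm_cat2l perm_map. Qed.

Lemma perm_beads_cons A B b k :
  perm_eq (beads A (b :: B) k) ((2 * (b + k)).+1 :: beads A B k).
Proof. by rewrite /beads !map_cat /= catA -cat1s perm_catCA /= -catA. Qed.

Lemma beads_uniq A B k : uniq A -> uniq B -> uniq (beads A B k).
Proof.
move=> A_uniq B_uniq; rewrite cat_uniq; apply/and3P; split.
- by rewrite map_inj_uniq // => x y; lia.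
- by apply/hasPn => _ /mapP[m _ ->]; apply/mapP => -[a _]; lia.
rewrite map_inj_uniq => [|x y [] ]; last by lia.
rewrite cat_uniq iota_uniq /= map_inj_uniq ?B_uniq ?andbT => [|x y]; last by lia.
by apply/hasPn => _ /mapP[b _ ->]; rewrite mem_iota; lia.
Qed.

(* Weights with which the moves [2a -> 2a - 2] and [2(b+k)+1 -> 2(b+k)-1]
   contribute to the derivative of [chi (beads A B k)], once the product over
   the [k] lowest odd beads has been telescoped. *)
Definition even_move (A B : seq nat) (a k : nat) : rat :=
  2%:R * a%:R * (2%:R * a%:R - 1 - 2%:R * k%:R) *
  (\prod_(c <- rem a A) ((a%:R - 1 - c%:R) / (a%:R - c%:R)) *
   \prod_(b <- B) ((2%:R * a%:R - 3%:R - 2%:R * b%:R - 2%:R * k%:R) /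
                   (2%:R * a%:R - 1 - 2%:R * b%:R - 2%:R * k%:R))).

Definition odd_move (A B : seq nat) (b k : nat) : rat :=
  2%:R * b%:R * (2%:R * b%:R + 1 + 2%:R * k%:R) *
  (\prod_(c <- rem b B) ((b%:R - 1 - c%:R) / (b%:R - c%:R)) *
   \prod_(a <- A) ((2%:R * b%:R - 1 - 2%:R * a%:R + 2%:R * k%:R) /
                   (2%:R * b%:R + 1 - 2%:R * a%:R + 2%:R * k%:R))).

(** Parity; it keeps the denominators of the weights nonzero at every natural [k]. *)
Lemma odd_natr_neq0 (x y : nat) : 2%:R * x%:R - 1 - 2%:R * y%:R != 0 :> rat.
Proof.
apply/eqP => E; have : ((2 * x)%N%:R == (2 * y).+1%:R :> rat).
  by apply/eqP; rewrite -natr1 !natrM; lra.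
by rewrite eqr_nat; lia.
Qed.

(** Each numerator is the next denominator. The leading factor is [n - 1] for [n = 2a] and cancels
    the first denominator. *)
Lemma prod_even_bulk (a k : nat) :
  (2%:R * a%:R - 1) * \prod_(m <- iota 0 k)
     ((2%:R * a%:R - 3%:R - 2%:R * m%:R) / (2%:R * a%:R - 1 - 2%:R * m%:R)) =
  2%:R * a%:R - 1 - 2%:R * k%:R :> rat.
Proof.
elim: k => [|k IHk]; first by rewrite big_nil; ring.
rewrite -[k.+1]addn1 iotaD big_cat big_seq1 mulrA IHk natrD /=.
by field; exact: odd_natr_neq0.
Qed.

Lemma prod_odd_bulk (b k : nat) :
  (b + k)%:R * \prod_(m <- iota 0 k)
     (((b + k)%:R - 1 - m%:R) / ((b + k)%:R - m%:R)) = b%:R :> rat.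
Proof.
(* Induction on a prefix length [j] keeps [b + k] fixed. *)
suff H j : (j <= k)%N -> (b + k)%:R * \prod_(m <- iota 0 j)
     (((b + k)%:R - 1 - m%:R) / ((b + k)%:R - m%:R)) = (b + k)%:R - j%:R :> rat.
  by rewrite H // natrD addrK.
elim: j => [|j IHj] jk; first by rewrite big_nil; ring.
rewrite -[j.+1]addn1 iotaD big_cat big_seq1 mulrA IHj ?(ltnW jk) // [in RHS]natrD /=.
by field; rewrite -natrD subr_eq0 eqr_nat; lia.
Qed.

Lemma chi_coef_rec ns J : uniq ns ->
  (chi ns)`_J.+1 *+ J.+1 = \sum_(n <- ns)
    ((n * n.-1)%:R * \prod_(m <- rem n ns) ((n.-2%:R - m%:R) / (n%:R - m%:R)))
    * (chi (n.-2 :: rem n ns))`_J.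
Proof.
move=> ns_uniq; rewrite -coef_deriv deriv_chi // coef_sum.
by apply: eq_bigr => n _; rewrite coefZ.
Qed.

Lemma half_frac (x y : rat) : (2%:R * x) / (2%:R * y) = x / y.
Proof. by rewrite -mulf_div divff ?mul1r. Qed.

(** The product splits in three: factors 2 cancel among even beads, the [k] low odd beads telescope,
    and the upper odd beads are kept. *)
Lemma even_move_term A B k J a : a \in A ->
  let n := (2 * a)%N in let ns := beads A B k in
  ((n * n.-1)%:R * \prod_(m <- rem n ns) ((n.-2%:R - m%:R) / (n%:R - m%:R)))
    * (chi (n.-2 :: rem n ns))`_J
  = even_move A B a k * (chi (beads (a.-1 :: rem a A) B k))`_J.
Proof.
case: a => [|a] aA n ns; first by rewrite /even_move mulr0 !mul0r.
have n1E : n.-1 = (2 * a).+1 by rewrite /n; lia.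
have n2E : n.-2 = (2 * a)%N by rewrite n1E.
have pR : perm_eq (rem n ns) (beads (rem a.+1 A) B k).
  rewrite -(perm_cons n) -(permPr (perm_beads k (perm_to_rem aA) (perm_refl B))).
  rewrite perm_sym; apply: perm_to_rem.
  by rewrite mem_cat map_f.
have -> : chi (n.-2 :: rem n ns) = chi (beads (a :: rem a.+1 A) B k).
  by apply: perm_chi; rewrite n2E perm_cons.
rewrite n2E n1E; congr (_ * _).
rewrite (perm_big _ pR) /beads big_cat map_cat big_cat !big_map /=.
rewrite /even_move; set E1 := \prod_(c <- _) _; set E2 := \prod_(b <- B) _.
set F1 := \prod_(i <- rem _ _) _; set F2 := \prod_(i <- iota _ _) _.
set F3 := \prod_(i <- B) _.
have -> : F1 = E1.
  apply: eq_bigr => c _; rewrite -[RHS]half_frac /n.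
  by congr (_ / _); ring.
have -> : F3 = E2.
  apply: eq_bigr => b _; rewrite /n.
  by congr (_ / _); ring.
have := prod_even_bulk a.+1 k.
have -> : \prod_(m <- iota 0 k)
    ((2%:R * a.+1%:R - 3%:R - 2%:R * m%:R) / (2%:R * a.+1%:R - 1 - 2%:R * m%:R)) = F2.
  apply: eq_bigr => c _; rewrite /n.
  by congr (_ / _); ring.
by move=> <-; rewrite /n; ring.
Qed.

Lemma odd_move_term A B k J b : b \in B ->
  let n := (2 * (b + k)).+1 in let ns := beads A B k in
  ((n * n.-1)%:R * \prod_(m <- rem n ns) ((n.-2%:R - m%:R) / (n%:R - m%:R)))
    * (chi (n.-2 :: rem n ns))`_J
  = odd_move A B b k * (chi (beads A (b.-1 :: rem b B) k))`_J.
Proof.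
move=> bB n ns.
(* The bead sits at 1 and both weights vanish. Otherwise [n.-2] is a true subtraction. *)
case: (posnP (b + k)%N) => [b0|bk].
  rewrite {1 2}/n b0 /= !muln0 !mul0r /odd_move (_ : b = 0%N); last by lia.
  by rewrite mulr0 !mul0r.
have pns : perm_eq ns (n :: beads A (rem b B) k).
  by rewrite (permPl (perm_beads k (perm_refl A) (perm_to_rem bB))) perm_beads_cons.
have pR : perm_eq (rem n ns) (beads A (rem b B) k).
  rewrite -(perm_cons n) -(permPr pns) perm_sym; apply: perm_to_rem.
  by rewrite (perm_mem pns) mem_head.
have coefE : (n * n.-1)%:R * \prod_(m <- rem n ns) ((n.-2%:R - m%:R) / (n%:R - m%:R))
             = odd_move A B b k.
  have n2E : n.-2%:R = 2%:R * b%:R + 2%:R * k%:R - 1 :> rat.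
    by rewrite /n /= -subn1 natrB ?muln_gt0 // natrM natrD; ring.
  rewrite n2E (perm_big _ pR) /beads big_cat map_cat big_cat !big_map /=.
  rewrite /odd_move; set E1 := \prod_(c <- _) _; set E2 := \prod_(a <- A) _.
  set F1 := \prod_(i <- A) _; set F2 := \prod_(i <- iota _ _) _.
  set F3 := \prod_(i <- rem _ _) _.
  have -> : F1 = E2.
    apply: eq_bigr => c _; rewrite /n.
    by congr (_ / _); ring.
  have -> : F3 = E1.
    apply: eq_bigr => c _; rewrite -[RHS]half_frac /n.
    by congr (_ / _); ring.
  have := prod_odd_bulk b k.
  have -> : \prod_(m <- iota 0 k) (((b + k)%:R - 1 - m%:R) / ((b + k)%:R - m%:R)) = F2.
    apply: eq_bigr => c _; rewrite -[LHS]half_frac /n.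
    by congr (_ / _); ring.
  move: F2 E1 E2 => F2 E1 E2 bE; rewrite -[X in 2%:R * X * _]bE /n; ring.
(* For [b = 0] the truncated [b.-1] names the wrong target, but the weight is 0. *)
rewrite coefE; case: (posnP b) => [b0|b_gt0].
  by have -> : odd_move A B b k = 0; rewrite ?mul0r // /odd_move b0 mulr0 !mul0r.
congr (_ * (polyseq _)`_J); apply: perm_chi.
rewrite (_ : n.-2 = (2 * (b.-1 + k)).+1); last by rewrite /n; lia.
by rewrite perm_sym (permPl (perm_beads_cons _ _ _ _)) perm_cons perm_sym.
Qed.

(** The bead at 1 has [n.-1 = 0]; any other low odd bead would land on its occupied neighbour, which
    makes a factor of the product zero. *)
Lemma bulk_move_term A B k J i : (i < k)%N -> uniq A -> uniq B ->
  let n := (2 * i).+1 in let ns := beads A B k in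
  ((n * n.-1)%:R * \prod_(m <- rem n ns) ((n.-2%:R - m%:R) / (n%:R - m%:R)))
    * (chi (n.-2 :: rem n ns))`_J = 0.
Proof.
case: i => [|i] ik A_uniq B_uniq n ns; first by rewrite muln0 !mul0r.
have n2 : n.-2 \in rem n ns.
  rewrite mem_rem_uniq ?beads_uniq // inE; apply/andP; split; first by rewrite /n; lia.
  rewrite mem_cat; apply/orP; right; rewrite (_ : n.-2 = (2 * i).+1); last by rewrite /n; lia.
  by rewrite map_f // mem_cat mem_iota; lia.
by rewrite (big_rem _ n2) /= subrr !mul0r mulr0 mul0r.
Qed.

Lemma chi_beads_rec A B k J : uniq A -> uniq B ->
  (chi (beads A B k))`_J.+1 *+ J.+1 =
    \sum_(a <- A) even_move A B a k * (chi (beads (a.-1 :: rem a A) B k))`_J +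
    \sum_(b <- B) odd_move A B b k * (chi (beads A (b.-1 :: rem b B) k))`_J.
Proof.
move=> A_uniq B_uniq; rewrite chi_coef_rec ?beads_uniq //.
rewrite {1}/beads big_cat map_cat big_cat !big_map /=; congr (_ + _).
  by apply: eq_big_seq => a aA; rewrite even_move_term.
rewrite big1_seq ?add0r => [|i]; last first.
  by rewrite mem_iota => /andP[_ ik]; rewrite bulk_move_term.
by apply: eq_big_seq => b bB; rewrite odd_move_term.
Qed.

(** * Rationality and polynomiality in [k] *)

Lemma ratfun_affine (u e : rat) : ratfun 1 (fun k => u + e * k%:R).
Proof.
apply: (@eq_ratfun _ (fun k : nat => (e%:P * 'X + u%:P).[k%:R])) => [k|].
  by rewrite hornerMXaddC hornerC addrC.
by apply: ratfun_horner; rewrite size_MXaddC; case: ifP => // _; rewrite ltnS size_polyC_leq1.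
Qed.

(** The common nonzero slope gives numerator and denominator the same degree 1. *)
Lemma ratfun_affine_frac (u v e : rat) : e != 0 ->
  (forall k : nat, v + e * k%:R != 0) ->
  ratfun 0 (fun k => (u + e * k%:R) / (v + e * k%:R)).
Proof.
move=> e0 v0; pose p w : {poly rat} := e%:P * 'X + w%:P.
have pE w x : (p w).[x] = w + e * x by rewrite hornerMXaddC hornerC addrC.
have sz_p w : size (p w) = 2 by rewrite size_MXaddC polyC_eq0 (negbTE e0) size_polyC e0.
apply: (@eq_ratfun _ (fun k : nat => (p u).[k%:R] / (p v).[k%:R])) => [k|].
  by rewrite !pE.
by apply: ratfun_frac => [k|]; rewrite ?pE ?sz_p.
Qed.

(** Only the affine factor left by telescoping raises the degree; the others are constants or ratios
    of affine functions of equal slope. *)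
Lemma ratfun_even_move A B a : ratfun 1 (even_move A B a).
Proof.
apply: (@eq_ratfun _ (fun k =>
  (2%:R * a%:R * (2%:R * a%:R - 1) + - (2%:R * a%:R * 2%:R) * k%:R) *
  ((\prod_(c <- rem a A) ((a%:R - 1 - c%:R) / (a%:R - c%:R))) *
   \prod_(b <- B) ((2%:R * a%:R - 3%:R - 2%:R * b%:R + - 2%:R * k%:R) /
                   (2%:R * a%:R - 1 - 2%:R * b%:R + - 2%:R * k%:R))))).
  move=> k; rewrite /even_move; congr (_ * (_ * _)); first by ring.
  by apply: eq_bigr => b _; rewrite !mulNr.
apply: (@ratfunM 1 0); first exact: ratfun_affine.
apply: (@ratfunM 0 0); first exact: ratfun_const.
apply: ratfun_prod => b; apply: ratfun_affine_frac => // k.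
have := odd_natr_neq0 a (b + k); rewrite natrD mulrDr.
by apply: contraNneq => E; apply/eqP; lra.
Qed.

Lemma ratfun_odd_move A B b : ratfun 1 (odd_move A B b).
Proof.
apply: (@eq_ratfun _ (fun k =>
  (2%:R * b%:R * (2%:R * b%:R + 1) + 2%:R * b%:R * 2%:R * k%:R) *
  ((\prod_(c <- rem b B) ((b%:R - 1 - c%:R) / (b%:R - c%:R))) *
   \prod_(a <- A) ((2%:R * b%:R - 1 - 2%:R * a%:R + 2%:R * k%:R) /
                   (2%:R * b%:R + 1 - 2%:R * a%:R + 2%:R * k%:R))))).
  by move=> k; rewrite /odd_move; congr (_ * _); ring.
apply: (@ratfunM 1 0); first exact: ratfun_affine.
apply: (@ratfunM 0 0); first exact: ratfun_const.
apply: ratfun_prod => a; apply: ratfun_affine_frac => // k.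
have := odd_natr_neq0 a (b + k); rewrite natrD mulrDr.
by apply: contraNneq => E; apply/eqP; lra.
Qed.

(** Forbidden moves have weight 0, so the recursion stays among duplicate-free lists. *)
Lemma even_move_eq0 A B a k :
  (a == 0%N) || ~~ uniq (a.-1 :: rem a A) -> uniq A -> even_move A B a k = 0.
Proof.
move=> + A_uniq; case: a => [|a]; first by rewrite /even_move mulr0 !mul0r.
rewrite /= rem_uniq // andbT negbK => a_A.
by rewrite /even_move (big_rem a) //= -[a.+1%:R]natr1 addrK subrr !mul0r mulr0.
Qed.

Lemma odd_move_eq0 A B b k :
  (b == 0%N) || ~~ uniq (b.-1 :: rem b B) -> uniq B -> odd_move A B b k = 0.
Proof.
move=> + B_uniq; case: b => [|b]; first by rewrite /odd_move mulr0 !mul0r.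
rewrite /= rem_uniq // andbT negbK => b_B.
by rewrite /odd_move (big_rem b) //= -[b.+1%:R]natr1 addrK subrr !mul0r mulr0.
Qed.

(** Each further coefficient costs one move, whose weight has degree at most 1. Moves change [A] and
    [B], so the induction quantifies over them. *)
Lemma ratfun_chi J A B : uniq A -> uniq B ->
  ratfun J (fun k => (chi (beads A B k))`_J).
Proof.
elim: J A B => [|J IHJ] A B A_uniq B_uniq.
  by apply: eq_ratfun (ratfun_const 0 1) => k; rewrite chi_coef0 ?beads_uniq.
apply: (@eq_ratfun _ (fun k => J.+1%:R^-1 *
    (\sum_(a <- A) even_move A B a k * (chi (beads (a.-1 :: rem a A) B k))`_J +
     \sum_(b <- B) odd_move A B b k * (chi (beads A (b.-1 :: rem b B) k))`_J))).
  by move=> k; rewrite -chi_beads_rec // -[X in _^-1 * X]mulr_natl mulKf ?pnatr_eq0.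
apply: (@ratfunM 0 J.+1); first exact: ratfun_const.
apply: ratfunD; apply: ratfun_sum => n.
  have [n0|] := boolP ((n == 0%N) || ~~ uniq (n.-1 :: rem n A)).
    by apply: eq_ratfun (ratfun_const _ 0) => k; rewrite even_move_eq0 ?mul0r.
  rewrite negb_or negbK => /andP[_ A'_uniq].
  by apply: (@ratfunM 1 J); [exact: ratfun_even_move | exact: IHJ].
have [n0|] := boolP ((n == 0%N) || ~~ uniq (n.-1 :: rem n B)).
  by apply: eq_ratfun (ratfun_const _ 0) => k; rewrite odd_move_eq0 ?mul0r.
rewrite negb_or negbK => /andP[_ B'_uniq].
by apply: (@ratfunM 1 J); [exact: ratfun_odd_move | exact: IHJ].
Qed.

Lemma chi_coef_poly J A B : uniq A -> uniq B ->
  exists P : {poly rat}, (size P <= J.+1)%N /\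
    forall k : nat, (chi (beads A B k))`_J = P.[k%:R].
Proof.
move=> A_uniq B_uniq; apply: (ratfun_int_poly (fact_gt0 J)).
  exact: ratfun_chi.
by move=> k; exact: chi_coef_int.
Qed.

(** * Degree bound for [chi] *)

Lemma leq_bin2_sumn s : uniq s -> ('C(size s, 2) <= sumn s)%N.
Proof.
have [n] := ubnP (size s); elim: n s => // n IHn [|x s] // sz_s s_uniq.
(* Pigeonhole: otherwise all elements would fit into [iota 0 (size s)]. *)
have [y ys y_ge] : exists2 y, y \in x :: s & (size s <= y)%N.
  apply/hasP; apply: contraT => /hasPn s_lt.
  suff : (size (x :: s) <= size (iota 0 (size s)))%N by rewrite size_iota ltnn.
  apply: uniq_leq_size => // y ys; rewrite mem_iota /= add0n ltnNge.
  exact: s_lt.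
have szr : size (rem y (x :: s)) = size s by rewrite size_rem.
have := IHn (rem y (x :: s)); rewrite szr rem_uniq // => /(_ sz_s isT) IH.
by rewrite (perm_sumn (perm_to_rem ys)) /= binS bin1 addnC leq_add.
Qed.

(** A move lowers the total of [A] and [B] by 1, and [leq_bin2_sumn] bounds this total below; more
    moves than the excess leave nothing. *)
Lemma chi_beads_eq0 J A B k : uniq A -> uniq B ->
  (sumn A + sumn B < 'C(size A, 2) + 'C(size B, 2) + J)%N ->
  (chi (beads A B k))`_J = 0.
Proof.
elim: J A B => [|J IHJ] A B A_uniq B_uniq ltJ.
  by have := leq_bin2_sumn A_uniq; have := leq_bin2_sumn B_uniq; lia.
have := chi_beads_rec k J A_uniq B_uniq.
rewrite !big1_seq ?addr0 => [/eqP||].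
- by rewrite mulrn_eq0 => /eqP.
- move=> b /= bB.
  have [n0|] := boolP ((b == 0%N) || ~~ uniq (b.-1 :: rem b B)).
    by rewrite odd_move_eq0 ?mul0r.
  rewrite negb_or negbK => /andP[b0 B'_uniq]; rewrite IHJ ?mulr0 //.
  move: ltJ; rewrite (perm_sumn (perm_to_rem bB)) /= size_rem //.
  rewrite prednK; last by case: (B) bB.
  by rewrite -{1}(prednK (_ : (0 < b)%N)) ?lt0n // addSn !addnS ltnS.
move=> a /= aA.
have [n0|] := boolP ((a == 0%N) || ~~ uniq (a.-1 :: rem a A)).
  by rewrite even_move_eq0 ?mul0r.
rewrite negb_or negbK => /andP[a0 A'_uniq]; rewrite IHJ ?mulr0 //.
move: ltJ; rewrite (perm_sumn (perm_to_rem aA)) /= size_rem //.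
rewrite prednK; last by case: (A) aA.
by rewrite -{1}(prednK (_ : (0 < a)%N)) ?lt0n // !addSn !addnS ltnS.
Qed.

(** * Hermite polynomials and Maya diagrams *)

Lemma HeSS n : He n.+2 = 'X * He n.+1 - n.+1%:R *: He n.
Proof. by rewrite /He /=; case: (He_pair n). Qed.

Lemma deriv_He n : (He n)^`() = n%:R *: He n.-1.
Proof.
suff: (He n)^`() = n%:R *: He n.-1 /\ (He n.+1)^`() = n.+1%:R *: He n by case.
elim: n => [|n [IHn IHn1]].
  by rewrite derivC derivX scale0r scale1r.
split=> //; rewrite HeSS derivB derivM derivX derivZ IHn1 IHn mul1r.
rewrite -[n.+2%:R]natr1 scalerDl scale1r -addrA [LHS]addrC; congr (_ + _).
have -> : He n.+1 = 'X * He n - n%:R *: He n.-1.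
  by case: (n) => [|m]; [rewrite scale0r subr0 mulr1 | rewrite HeSS].
by rewrite scalerBr scalerAr.
Qed.

Lemma derivn_He n i : (He n)^`(i) = (n ^_ i)%:R *: He (n - i).
Proof.
elim: i => [|i IHi]; first by rewrite scale1r subn0.
by rewrite derivnS IHi derivZ deriv_He scalerA -natrM -ffactnSr subnS.
Qed.

Lemma ffactnD n i j : (n ^_ (i + j) = n ^_ i * (n - i) ^_ j)%N.
Proof.
elim: j => [|j IHj]; first by rewrite addn0 muln1.
by rewrite addnS !ffactnSr IHj subnDA mulnA.
Qed.

Lemma hgenE i n : hgen i n = (n ^_ i)%:R *: hgen 0 (n - i).
Proof.
apply/polyP => m; rewrite coefZ !coef_hgen add0n ffactnD natrM.
by rewrite mulrA.
Qed.

(** The Hermite recurrence divided by [x ^+ n.+2], in the variable [-1 / (2 x^2)]. *)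
Lemma hgen0SS n :
  hgen 0 n.+2 = hgen 0 n.+1 + (2%:R * n.+1%:R) *: ('X * hgen 0 n).
Proof.
apply/polyP => -[|m]; rewrite coefD coefZ coefXM !coef_hgen !add0n /=.
  by rewrite mulr0 addr0.
rewrite mulnS ffactnS ffactSS ffactSS ffactnSr factS !natrM.
have m1 : m.+1%:R != 0 :> rat by rewrite pnatr_eq0.
have mf : m`!%:R != 0 :> rat by rewrite pnatr_eq0 -lt0n fact_gt0.
case: (leqP (2 * m) n) => [mn|nm]; last by rewrite ffact_small //; ring.
rewrite natrB // natrM; move: (_`!%:R) mf (n ^_ _)%:R => F F0 G.
by field; rewrite F0 nat1r.
Qed.

Lemma horner_He n (x : rat) : x != 0 ->
  (He n).[x] = x ^+ n * (hgen 0 n).[- (2%:R * x ^+ 2)^-1].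
Proof.
move=> x0.
suff: (He n).[x] = x ^+ n * (hgen 0 n).[- (2%:R * x ^+ 2)^-1] /\
      (He n.+1).[x] = x ^+ n.+1 * (hgen 0 n.+1).[- (2%:R * x ^+ 2)^-1] by case.
elim: n => [|n [IHn IHn1]].
  have h1 n : (n <= 1)%N -> hgen 0 n = 1.
    move=> n1; apply/polyP => -[|m]; rewrite coef_hgen coef1 /= ?divr1 //.
    by rewrite ffact_small ?mul0r //; lia.
  by rewrite !h1 // !hornerE.
split=> //; rewrite HeSS hgen0SS !(hornerD, hornerN, hornerZ, hornerM, hornerX) IHn IHn1.
by rewrite !exprSr; field.
Qed.

Lemma horner_derivn_He n i (x : rat) : x != 0 ->
  x ^+ i * ((He n)^`(i)).[x] = x ^+ n * (hgen i n).[- (2%:R * x ^+ 2)^-1].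
Proof.
move=> x0; rewrite derivn_He hgenE !hornerZ horner_He //.
have [ni|i_n] := ltnP n i; first by rewrite ffact_small // !mul0r !mulr0.
have -> : x ^+ n = x ^+ i * x ^+ (n - i) by rewrite -exprD subnKC.
by ring.
Qed.

Lemma WronskianE ns :
  Wronskian [seq He n | n <- ns] = alternant (fun i n => (He n)^`(i)) ns.
Proof.
have E fs n : size fs = n ->
    Wronskian fs = \det (\matrix_(i < n, j < n) (fs`_j)^`(i)) by move=> <-.
rewrite (E _ (size ns)) ?size_map //; congr (\det _).
by apply/matrixP => i j; rewrite !mxE (nth_map 0%N).
Qed.

(** Scaling row [i] by [x ^+ i] on the left matches scaling the column of bead [n] by [x ^+ n] on
    the right. *)
Lemma horner_Wronskian_He ns (x : rat) : x != 0 ->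
  x ^+ 'C(size ns, 2) * (Wronskian [seq He n | n <- ns]).[x] =
  x ^+ sumn ns * (alternant hgen ns).[- (2%:R * x ^+ 2)^-1].
Proof.
move=> x0; set y := - _; rewrite WronskianE.
have diagE n (e : 'I_n -> nat) : x ^+ (\sum_i e i) = \det (diag_mx (\row_i x ^+ e i)).
  by rewrite det_diag expr_sum; apply: eq_bigr => i _; rewrite mxE.
rewrite -bin2_sum big_mkord (diagE (size ns) (fun i => nat_of_ord i)).
rewrite sumnE (big_nth 0%N) big_mkord (diagE _ (fun j : 'I_(size ns) => nth 0%N ns j)).
rewrite -!horner_evalE -!det_map_mx -det_mulmx [RHS]mulrC -det_mulmx.
congr (\det _); apply/matrixP => i j; rewrite mul_diag_mx mul_mx_diag !mxE /=.
by rewrite !horner_evalE horner_derivn_He // mulrC.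
Qed.

(** * Degree vectors and translated Maya diagrams *)

Lemma degvec_cons x l : degvec (x :: l) = (x + size l)%N :: degvec l.
Proof.
rewrite /degvec /= subn1 /=; congr (_ :: _).
rewrite -[1%N]addn0 iotaDl -map_comp; apply: eq_map => i /=.
by rewrite subSS.
Qed.

Lemma size_degvec l : size (degvec l) = size l.
Proof. by rewrite size_map size_iota. Qed.

Lemma size_maya_shift l t : size (maya_shift l t) = (size l + t)%N.
Proof. by rewrite size_cat size_iota size_map size_degvec addnC. Qed.

Lemma bin2D m n : 'C(m + n, 2) = ('C(m, 2) + 'C(n, 2) + m * n)%N.
Proof.
elim: m => [|m IHm]; first by rewrite add0n mul0n addn0.
by rewrite addSn !binS !bin1 IHm mulSn; lia.
Qed.

Lemma sumn_degvec l : sumn (degvec l) = (psize l + 'C(size l, 2))%N.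
Proof.
elim: l => [|x l IHl] //; rewrite degvec_cons /= IHl binS bin1 /psize /=.
by lia.
Qed.

Lemma sumn_iota n : sumn (iota 0 n) = 'C(n, 2).
Proof. by rewrite -bin2_sum sumnE /index_iota subn0. Qed.

Lemma sumn_map_addn s t : sumn [seq (n + t)%N | n <- s] = (sumn s + size s * t)%N.
Proof. by elim: s => //= x s ->; rewrite mulSn; lia. Qed.

Lemma sumn_maya_shift l t :
  sumn (maya_shift l t) = (psize l + 'C(size l + t, 2))%N.
Proof.
rewrite sumn_cat sumn_iota sumn_map_addn sumn_degvec size_degvec bin2D.
by lia.
Qed.

Lemma maya_shiftS l t : maya_shift l t.+1 = 0%N :: map succn (maya_shift l t).
Proof.
rewrite /maya_shift /= map_cat -map_comp -[1%N]addn0 iotaDl.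
by congr (_ :: (_ ++ _)); apply: eq_map => n /=; rewrite addnS.
Qed.

Lemma chi_maya_shift l t : chi (maya_shift l t) = chi (degvec l).
Proof.
elim: t => [|t IHt]; last by rewrite maya_shiftS chi_cons0.
by rewrite /maya_shift /= (eq_map addn0) map_id.
Qed.

(** Both sides carry the same Vandermonde denominator, and [sumn_degvec] reduces the exponents to
    [psize l]. *)
Lemma horner_HeP l (x : rat) : x != 0 ->
  (HeP l).[x] = x ^+ psize l * (chi (degvec l)).[- (2%:R * x ^+ 2)^-1].
Proof.
move=> x0; have xC0 : x ^+ 'C(size l, 2) != 0 by rewrite expf_neq0.
apply: (mulfI xC0); rewrite mulrA -exprD addnC -sumn_degvec.
rewrite !hornerZ mulrCA -[in LHS]size_degvec horner_Wronskian_He // mulrCA.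
by [].
Qed.

Lemma is_partition_cons x l : is_partition (x :: l) -> is_partition l /\
  forall n, n \in degvec l -> (n < x + size l)%N.
Proof.
rewrite /is_partition /= => /andP[]; rewrite path_sortedE; last first.
  by move=> a b c ba cb; apply: leq_trans ba.
move=> /andP[/allP x_ge l_sorted] /andP[x0 l0]; rewrite l_sorted l0; split=> //.
move=> n /mapP[i]; rewrite mem_iota /= add0n => il ->.
have /= := x_ge _ (mem_nth 0%N il); lia.
Qed.

Lemma degvec_uniq l : is_partition l -> uniq (degvec l).
Proof.
elim: l => [|x l IHl] // /is_partition_cons[/IHl l_uniq l_lt].
by rewrite degvec_cons /= l_uniq andbT; apply/negP => /l_lt; rewrite ltnn.
Qed.

Lemma maya_shift_uniq l t : is_partition l -> uniq (maya_shift l t).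
Proof.
move=> /degvec_uniq l_uniq; rewrite cat_uniq iota_uniq map_inj_uniq => [|x y]; last by lia.
rewrite l_uniq andbT /=; apply/hasPn => _ /mapP[n _ ->].
by rewrite mem_iota; lia.
Qed.

(** * Recovering a Maya diagram from its partition *)

(** [maya_partition] without sorting or removal of duplicates, suited to induction along a
    decreasing list. *)
Definition maya_counts (s : seq nat) : seq nat :=
  [seq maya_count s m | m <- s & (0 < maya_count s m)%N].

Lemma leq_maya_count s m n : (m <= n)%N -> (maya_count s m <= maya_count s n)%N.
Proof.
by move=> mn; rewrite /maya_count -(subnKC mn) iotaD count_cat leq_addr.
Qed.

Lemma maya_countE s x : uniq s -> (forall y, y \in s -> (y < x)%N) ->
  maya_count s x = (x - size s)%N.
Proof.
move=> s_uniq s_lt; have := count_predC (fun y => y \in s) (iota 0 x); rewrite size_iota.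
have -> : count (fun y => y \in s) (iota 0 x) = size s.
  rewrite -size_filter; apply: perm_size; apply: uniq_perm => //.
    by rewrite filter_uniq ?iota_uniq.
  move=> y; rewrite mem_filter mem_iota add0n /=.
  by case ys: (y \in s) => //=; rewrite s_lt.
by move=> E; rewrite -[in RHS]E addKn; apply: eq_count.
Qed.

Lemma maya_counts_cons x s : uniq s -> (forall y, y \in s -> (y < x)%N) ->
  maya_counts (x :: s) =
  if (size s < x)%N then (x - size s)%N :: maya_counts s else maya_counts s.
Proof.
move=> s_uniq s_lt.
have cE m : (m <= x)%N -> maya_count (x :: s) m = maya_count s m.
  move=> mx; apply: eq_in_count => n; rewrite mem_iota inE => /andP[_ nm].
  by rewrite (ltn_eqF (leq_trans nm mx)).
rewrite /maya_counts /= cE // maya_countE // subn_gt0.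
have -> : [seq m <- s | (0 < maya_count (x :: s) m)%N] = [seq m <- s | (0 < maya_count s m)%N].
  by apply: eq_in_filter => y /s_lt/ltnW yx; rewrite cE.
have E : [seq maya_count (x :: s) m | m <- s & (0 < maya_count s m)%N] = maya_counts s.
  by apply/eq_in_map => y; rewrite mem_filter => /andP[_ /s_lt/ltnW yx]; rewrite cE.
by case: ifP => _; rewrite /= ?cE ?maya_countE // E.
Qed.

(** Induction on the largest bead [x]: if a gap lies below it, [x - size s] is a new first part,
    whose degree shifted back is [x]. *)
Lemma maya_counts_shift s : sorted (fun x y => (y < x)%N) s ->
  (size (maya_counts s) <= size s)%N /\
  perm_eq s (maya_shift (maya_counts s) (size s - size (maya_counts s))).
Proof.
elim: s => [|x s IHs] //= xs; have s_sorted := path_sorted xs.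
have gtn_trans : transitive (fun x y => (y < x)%N) by move=> a b c ba cb; apply: ltn_trans ba.
have s_uniq : uniq s by apply: sorted_uniq s_sorted => // y; rewrite ltnn.
have s_lt y : y \in s -> (y < x)%N.
  by move: xs; rewrite path_sortedE // => /andP[/allP/(_ y)].
have [sz_le perm_s] := IHs s_sorted.
have sx_le : (size s <= x)%N.
  rewrite -[X in (_ <= X)%N](size_iota 0); apply: uniq_leq_size => // y /s_lt.
  by rewrite mem_iota.
rewrite maya_counts_cons //; case: ltnP => [sx|xs_le].
  split=> //=; rewrite subSS /maya_shift degvec_cons /=.
  rewrite (_ : (x - size s + _ + _)%N = x); last by lia.
  by rewrite perm_sym -cat1s perm_catCA perm_cons perm_sym.
(* With no gap below [x], the beads form a full initial segment and the partition is empty. *)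
have sx : size s = x by apply/eqP; rewrite eqn_leq sx_le.
have c0 : maya_counts s = [::].
  rewrite /maya_counts (eq_in_filter (_ : {in s, _ =1 pred0})) ?filter_pred0 // => y ys.
  apply/negbTE; rewrite -eqn0Ngt -leqn0.
  rewrite (leq_trans (leq_maya_count s (ltnW (s_lt y ys)))) //.
  by rewrite maya_countE // leqn0 subn_eq0.
split; first by rewrite c0.
move: perm_s; rewrite c0 /= !subn0 /maya_shift !cats0 => perm_s.
rewrite -[(size s).+1]addn1 iotaD add0n /= cats1 perm_sym perm_rcons sx perm_cons.
by rewrite perm_sym -sx.
Qed.

(** With symmetry and translation invariance this identifies [chi S] with [chi] of the degree vector
    of the partition. *)
Lemma perm_maya_partition S : uniq S ->
  exists2 t, size S = (size (maya_partition S) + t)%N &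
    perm_eq S (maya_shift (maya_partition S) t).
Proof.
move=> S_uniq; set s := sort (fun x y => (y <= x)%N) S.
have sS : perm_eq s S by rewrite perm_sort.
have s_sorted : sorted (fun x y => (y < x)%N) s.
  have : sorted (fun x y => (y <= x)%N) s by apply: sort_sorted => x y; exact: leq_total.
  have : uniq s by rewrite sort_uniq.
  elim: (s) => // x [|y r] //= IHr /andP[x_yr yr_uniq] /andP[yx yr].
  rewrite IHr // ltn_neqAle yx !andbT; apply: contraNneq x_yr => ->.
  by rewrite mem_head.
have cE m : maya_count s m = maya_count S m.
  by apply: eq_count => n; rewrite (perm_mem sS).
have -> : maya_partition S = maya_counts s.
  rewrite /maya_partition undup_id //.
  (* Counts along a decreasing list already decrease weakly, so sorting fixes them. *)
  rewrite -[RHS](sorted_sort (leT := fun x y => (y <= x)%N)).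
  - apply/perm_sortP.
    + by move=> x y; exact: leq_total.
    + by move=> x y z yx zy; apply: leq_trans yx.
    + by move=> x y; rewrite andbC -eqn_leq => /eqP.
    rewrite /maya_counts (eq_map cE) (eq_filter (fun m => congr1 (leq 1) (cE m))).
    by rewrite perm_map // perm_filter // perm_sym.
  - by move=> x y z xy yz; apply: leq_trans yz xy.
  rewrite sorted_map; apply: sorted_filter => [x y z /= xy yz|].
    exact: leq_trans yz xy.
  by apply: sub_sorted s_sorted => x y /ltnW yx /=; exact: leq_maya_count.
have [sz_le perm_s] := maya_counts_shift s_sorted.
exists (size s - size (maya_counts s))%N; first by rewrite subnKC // (perm_size sS).
by rewrite -(permPl sS).
Qed.

(** * Bead sums and construction of [R] *)

(** The odd initial segment of length [size mu + k] is cut at [k]; its upper part joins [nu] to form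
    [B]. *)
Lemma Phi_beads mu nu k : Phi mu nu k =
  maya_partition (beads (maya_shift mu (size nu)) (maya_shift nu (size mu)) k).
Proof.
rewrite /Phi /beads; congr (maya_partition (_ ++ map _ _)).
rewrite /maya_shift [(size mu + k)%N]addnC iotaD map_cat -catA -map_comp add0n.
congr (_ ++ (_ ++ _)); last by apply: eq_map => n /=; rewrite addnA addnAC.
by rewrite -[k in LHS]addn0 iotaDl; apply: eq_map => n; rewrite addnC.
Qed.

Lemma size_beads A B k : size (beads A B k) = (size A + (k + size B))%N.
Proof. by rewrite size_cat !size_map size_cat size_iota size_map. Qed.

Lemma sumn_beads A B k : sumn (beads A B k) =
  (2 * sumn A + 2 * ('C(k, 2) + sumn B + size B * k) + (k + size B))%N.
Proof.
have E s : sumn [seq (2 * m).+1 | m <- s] = (2 * sumn s + size s)%N.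
  by elim: s => //= x s ->; lia.
have D s : sumn [seq (2 * m)%N | m <- s] = (2 * sumn s)%N.
  by elim: s => //= x s ->; lia.
rewrite sumn_cat E D sumn_cat sumn_iota sumn_map_addn size_cat size_iota size_map.
by lia.
Qed.

Lemma psize_staircase k : psize (staircase k) = 'C(k.+1, 2).
Proof.
rewrite /psize /staircase sumn_rev binS bin1 -sumn_iota -[1%N]addn0 iotaDl.
rewrite (@eq_map _ _ (addn 1) (fun n => n + 1)%N (addnC 1)) sumn_map_addn size_iota muln1.
by rewrite addnC.
Qed.

(** Positive integers supply enough points while avoiding 0, where [-1 / (2 x^2)] has its pole. *)
Lemma poly_eq_horner (p q : {poly rat}) :
  (forall x, x != 0 -> p.[x] = q.[x]) -> p = q.
Proof.
move=> pq; apply/eqP; rewrite -subr_eq0; apply/eqP.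
apply: (@roots_geq_poly_eq0 _ _ [seq n%:R | n <- iota 1 (size (p - q))]).
- apply/allP => _ /mapP[n + ->]; rewrite mem_iota => /andP[n0 _].
  by rewrite /root hornerD hornerN pq ?subrr // pnatr_eq0 -lt0n.
- by rewrite map_inj_uniq ?iota_uniq // => x y /eqP; rewrite eqr_nat => /eqP.
by rewrite size_map size_iota.
Qed.

Lemma bin2_double n : ('C(n, 2) * 2 + n = n * n)%N.
Proof. by elim: n => // n; rewrite binS bin1; lia. Qed.

Unset Implicit Arguments.

Theorem theorem4p9 (mu nu : seq nat) :
  is_partition mu -> is_partition nu ->
  forall j : nat, (j <= psize mu + psize nu)%N ->
  exists P : {poly rat}, (size P <= j.+1)%N /\
    forall k : nat, exists R : {poly rat},
      [/\ R \is monic, size R = (psize mu + psize nu).+1,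
          HeP (Phi mu nu k) = 'X^(psize (staircase k)) * (R \Po 'X^2)
        & R`_(psize mu + psize nu - j) = P.[k%:R]].
Proof.
move=> mu_part nu_part j j_le; set M := (psize mu + psize nu)%N in j_le *.
set A := maya_shift mu (size nu); set B := maya_shift nu (size mu).
have A_uniq : uniq A by exact: maya_shift_uniq.
have B_uniq : uniq B by exact: maya_shift_uniq.
have szA : size A = (size mu + size nu)%N by rewrite size_maya_shift.
have szB : size B = (size mu + size nu)%N by rewrite size_maya_shift addnC.
have sumA : sumn A = (psize mu + 'C(size A, 2))%N.
  by rewrite sumn_maya_shift size_maya_shift.
have sumB : sumn B = (psize nu + 'C(size B, 2))%N.
  by rewrite sumn_maya_shift size_maya_shift.
have [P [szP PE]] := chi_coef_poly j A_uniq B_uniq.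
exists ((- 2%:R^-1) ^+ j *: P); split=> [|k].
  exact: leq_trans (size_scale_leq _ _) szP.
set c := chi (beads A B k).
(* With [y = x^2], the coefficient of [y^i] in [y^M c(-1/(2y))] comes from the coefficient of index
   [M - i] in [c]. *)
pose r i := c`_(M - i) * (- 2%:R^-1) ^+ (M - i).
have rM : r M = 1 by rewrite /r subnn mulr1 chi_coef0 ?beads_uniq.
pose R := \poly_(i < M.+1) r i.
have szR : size R = M.+1 by rewrite size_poly_eq //= rM oner_eq0.
exists R; split=> //.
- by rewrite monicE lead_coefE szR coef_poly ltnSn rM.
- have S_uniq := beads_uniq k A_uniq B_uniq.
  have [t szS permS] := perm_maya_partition S_uniq.
  rewrite -Phi_beads in szS permS.
  (* Obtained by computing the sum of the beads on both sides of [permS]. *)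
  have psE : psize (Phi mu nu k) = (psize (staircase k) + 2 * M)%N.
    have szPhi := sumn_maya_shift (Phi mu nu k) t; rewrite -szS in szPhi.
    have sumS := perm_sumn permS; rewrite szPhi sumn_beads size_beads in sumS.
    rewrite psize_staircase; move: sumS sumA sumB; rewrite szA szB /M.
    move: (size mu + size nu)%N => d; rewrite !bin2D binS bin1.
    by have := bin2_double d; nia.
  apply: poly_eq_horner => x x0.
  rewrite horner_HeP // -(chi_maya_shift _ t) -(perm_chi permS) -/c psE.
  rewrite hornerM hornerXn horner_comp hornerXn exprD -mulrA; congr (_ * _).
  (* Degree at most [M] is what makes [y^M c(-1/(2y))] a polynomial in [y]. *)
  have szc : (size c <= M.+1)%N.
    apply/leq_sizeP => J MJ; apply: chi_beads_eq0 => //.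
    by rewrite sumA sumB addnACA addnC ltn_add2l.
  rewrite (horner_coef_wide _ szc) (horner_coef_wide _ (eq_leq szR)) mulr_sumr.
  rewrite [RHS](reindex_inj rev_ord_inj) /=; apply: eq_bigr => i _.
  have iM : (i <= M)%N by rewrite -ltnS.
  rewrite subSS coef_poly ltnS leq_subr /r subKn // exprM.
  have y0 : x ^+ 2 != 0 by rewrite expf_neq0.
  move: (x ^+ 2) y0 => y y0; rewrite invfM -mulNr exprMn.
  have -> : y ^+ M = y ^+ i * y ^+ (M - i) by rewrite -exprD subnKC.
  have yi0 : y ^+ i != 0 by rewrite expf_neq0.
  by rewrite exprVn; field.
rewrite coef_poly ltnS leq_subr /r subKn // hornerZ -PE mulrC.
by [].
Qed.
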